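(* Let $\mathbb{C}$ be a pointed category with finite limits and coequalizers. Then the following are equivalent. \begin{enumerate} \item $\mathbb{C}$ satisfies (P). \item The product of a regular epimorphism in $\mathbb{C}$ with an isomorphism in $\mathbb{C}$ is a regular epimorphism, and for any effective equivalence relation $C$ on any product $A\times B$ in $\mathbb{C}$, we have that $(x,0)\,C\,(y,0)$ implies $(x,z)\,C\,(y,z)$ for any generalized elements (morphisms) $x,y:S\to A$ and $z:S\to B$. \end{enumerate}
   Context: Property (P) for a category $\mathbb{C}$ with binary products: for any two coequalizer diagrams $C_1 \rightrightarrows X \xrightarrow{q_1} X'$ (with parallel pair $u,v$) and $C_2 \rightrightarrows Y \xrightarrow{q_2} Y'$ (with parallel pair $u',v'$) in $\mathbb{C}$, the diagram $C_1\times C_2 \rightrightarrows X\times Y \xrightarrow{q_1\times q_2} X'\times Y'$ (with parallel pair $u\times u'$, $v\times v'$) is a coequalizer diagram in $\mathbb{C}$. A pointed category is one with a zero object; $0$ denotes zero morphisms. An equivalence relation is effective if it is the kernel pair of some morphism. For a relation $C$ on an object $Z$ (a subobject of $Z\times Z$) and morphisms $a,b:S\to Z$, $a\,C\,b$ means that $(a,b):S\to Z\times Z$ factors through $C$. *)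

(* Defs.v *)
(* Stdlib only: neither Stdlib nor MathComp provides category theory. *)
From Stdlib Require Export FinFun.

Set Implicit Arguments.
Unset Strict Implicit.
Unset Printing Implicit Defensive.

Record Category : Type := {
  Ob :> Type;
  Hom : Ob -> Ob -> Type;
  idm : forall A, Hom A A;
  comp : forall A B D, Hom B D -> Hom A B -> Hom A D;
  comp_id_l : forall A B (f : Hom A B), comp (idm B) f = f;
  comp_id_r : forall A B (f : Hom A B), comp f (idm A) = f;
  comp_assoc : forall A B D E (h : Hom D E) (g : Hom B D) (f : Hom A B),
    comp h (comp g f) = comp (comp h g) f
}.

Arguments Hom {c} A B.
Arguments idm {c} A.
Arguments comp {c A B D} g f.

Declare Scope cat_scope.
Delimit Scope cat_scope with cat.
Open Scope cat_scope.
Notation "g '∘' f" := (comp g f) (at level 40, left associativity) : cat_scope.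

Record Functor (J C : Category) : Type := {
  fobj :> J -> C;
  fmap : forall i j : J, Hom i j -> Hom (fobj i) (fobj j);
  fmap_id : forall i : J, fmap (idm i) = idm (fobj i);
  fmap_comp : forall (i j k : J) (b : Hom j k) (a : Hom i j),
    fmap (b ∘ a) = fmap b ∘ fmap a
}.

Definition is_cone (J C : Category) (F : Functor J C) (L : C)
  (leg : forall i : J, Hom L (F i)) : Prop :=
  forall (i j : J) (a : Hom i j), fmap F a ∘ leg i = leg j.

Record Limit (J C : Category) (F : Functor J C) : Type := {
  lim_ob : C;
  lim_leg : forall i : J, Hom lim_ob (F i);
  lim_cone : is_cone lim_leg;
  lim_lift : forall (S : C) (leg : forall i : J, Hom S (F i)),
    is_cone leg -> Hom S lim_ob;
  lim_lift_leg : forall (S : C) (leg : forall i : J, Hom S (F i))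
    (H : is_cone leg) (i : J), lim_leg i ∘ lim_lift H = leg i;
  lim_ext : forall (S : C) (h k : Hom S lim_ob),
    (forall i : J, lim_leg i ∘ h = lim_leg i ∘ k) -> h = k
}.

Definition finite_category (J : Category) : Prop :=
  Finite J /\ forall i j : J, Finite (Hom i j).

Definition has_finite_limits (C : Category) : Prop :=
  forall (J : Category) (F : Functor J C),
    finite_category J -> inhabited (Limit F).

(* Binary products are not chosen globally: statements about A x B quantify
   over every [BinProduct A B]. *)
Record BinProduct (C : Category) (A B : C) : Type := {
  prod_ob :> C;
  pr1 : Hom prod_ob A;
  pr2 : Hom prod_ob B;
  pair : forall S : C, Hom S A -> Hom S B -> Hom S prod_ob;
  pr1_pair : forall (S : C) (f : Hom S A) (g : Hom S B), pr1 ∘ pair f g = f;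
  pr2_pair : forall (S : C) (f : Hom S A) (g : Hom S B), pr2 ∘ pair f g = g;
  pair_ext : forall (S : C) (h k : Hom S prod_ob),
    pr1 ∘ h = pr1 ∘ k -> pr2 ∘ h = pr2 ∘ k -> h = k
}.

Arguments pair {C A B} P {S} f g : rename.

Definition prod_map (C : Category) (A B A' B' : C)
  (P : BinProduct A B) (P' : BinProduct A' B')
  (f : Hom A A') (g : Hom B B') : Hom P P' :=
  pair P' (f ∘ pr1 P) (g ∘ pr2 P).

Record ZeroObject (C : Category) : Type := {
  zero_ob :> C;
  to_zero : forall A : C, Hom A zero_ob;
  from_zero : forall A : C, Hom zero_ob A;
  to_zero_uniq : forall (A : C) (f : Hom A zero_ob), f = to_zero A;
  from_zero_uniq : forall (A : C) (f : Hom zero_ob A), f = from_zero A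
}.

Definition zero_map (C : Category) (Z : ZeroObject C) (A B : C) : Hom A B :=
  from_zero Z B ∘ to_zero Z A.

Arguments zero_map {C} Z A B.

Definition is_iso (C : Category) (A B : C) (f : Hom A B) : Prop :=
  exists g : Hom B A, g ∘ f = idm A /\ f ∘ g = idm B.

Definition is_mono (C : Category) (A B : C) (m : Hom A B) : Prop :=
  forall (S : C) (h k : Hom S A), m ∘ h = m ∘ k -> h = k.

Definition is_coequalizer (C : Category) (K X X' : C)
  (u v : Hom K X) (q : Hom X X') : Prop :=
  q ∘ u = q ∘ v /\
  forall (T : C) (h : Hom X T), h ∘ u = h ∘ v ->
    exists! k : Hom X' T, k ∘ q = h.

Definition has_coequalizers (C : Category) : Prop :=
  forall (K X : C) (u v : Hom K X),
    exists (X' : C) (q : Hom X X'), is_coequalizer u v q.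

Definition is_regular_epi (C : Category) (X X' : C) (q : Hom X X') : Prop :=
  exists (K : C) (u v : Hom K X), is_coequalizer u v q.

Definition is_kernel_pair (C : Category) (K Z T : C)
  (f : Hom Z T) (r1 r2 : Hom K Z) : Prop :=
  f ∘ r1 = f ∘ r2 /\
  forall (S : C) (a b : Hom S Z), f ∘ a = f ∘ b ->
    exists! h : Hom S K, r1 ∘ h = a /\ r2 ∘ h = b.

(* A relation on Z is represented by a monomorphism into a product Z x Z;
   everything below is invariant under isomorphism of subobjects. *)
Record Relation (C : Category) (Z : C) (ZZ : BinProduct Z Z) : Type := {
  rel_ob : C;
  rel_incl : Hom rel_ob ZZ;
  rel_mono : is_mono rel_incl
}.

Definition related (C : Category) (Z : C) (ZZ : BinProduct Z Z)
  (R : Relation ZZ) (S : C) (a b : Hom S Z) : Prop :=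
  exists h : Hom S (rel_ob R), rel_incl R ∘ h = pair ZZ a b.

Definition is_equivalence_relation (C : Category) (Z : C)
  (ZZ : BinProduct Z Z) (R : Relation ZZ) : Prop :=
  forall S : C,
    (forall a : Hom S Z, related R a a) /\
    (forall a b : Hom S Z, related R a b -> related R b a) /\
    (forall a b c : Hom S Z, related R a b -> related R b c -> related R a c).

Definition is_effective_equivalence_relation (C : Category) (Z : C)
  (ZZ : BinProduct Z Z) (R : Relation ZZ) : Prop :=
  is_equivalence_relation R /\
  exists (T : C) (f : Hom Z T),
    is_kernel_pair f (pr1 ZZ ∘ rel_incl R) (pr2 ZZ ∘ rel_incl R).

Definition property_P (C : Category) : Prop :=
  forall (C1 X X' : C) (u v : Hom C1 X) (q1 : Hom X X')
    (C2 Y Y' : C) (u' v' : Hom C2 Y) (q2 : Hom Y Y')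
    (PC : BinProduct C1 C2) (PX : BinProduct X Y) (PX' : BinProduct X' Y'),
    is_coequalizer u v q1 ->
    is_coequalizer u' v' q2 ->
    is_coequalizer (prod_map PC PX u u') (prod_map PC PX v v')
      (prod_map PX PX' q1 q2).

(* Main.v *)
(* (1) => (2): for x, y : S -> A with coequalizer q, (P) applied to the pairs
   (x, y) and (0, 0) : 0 -> B makes q x 1 a coequalizer of (x,0) and (y,0), so
   a map f with f(x,0) = f(y,0) factors through q x 1, whence f(x,z) = f(y,z).
   (2) => (1): q1 x q2 = (1 x q2)(q1 x 1). If f(u x u') = f(v x v'), then
   f(-,0) coequalizes u and v, hence identifies everything that q1 does; the
   condition on the kernel pair of f upgrades this to f identifying everything
   that the regular epimorphism q1 x 1 does. The same argument in the other
   variable factors the result through 1 x q2. *)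
Require Import Defs.
From Stdlib Require Import List.

Definition discrete_pair : Category.
Proof.
  refine {| Ob := bool; Hom := fun i j => i = j; idm := fun i => eq_refl;
            comp := fun i j k b a => eq_trans a b |}.
  - intros i j []; reflexivity.
  - intros i j []; reflexivity.
  - intros i j k l [] [] []; reflexivity.
Defined.

Lemma discrete_pair_finite : finite_category discrete_pair.
Proof.
  split.
  - exists (true :: false :: nil); intros []; simpl; auto.
  - intros i j; destruct (Bool.bool_dec i j) as [e | n].
    + exists (e :: nil); intros e'; left; apply Eqdep_dec.UIP_dec.
      exact Bool.bool_dec.
    + exists nil; intros e; destruct (n e).
Qed.

Definition pair_functor (C : Category) (A B : C) : Functor discrete_pair C.
Proof.
  refine {| fobj := fun i : discrete_pair => if i then A else B;
            fmap := fun (i j : discrete_pair) (e : Hom i j) =>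
              match e in _ = k
                return Hom (if i then A else B) (if k then A else B)
              with eq_refl => idm _ end |}.
  - reflexivity.
  - intros i j k [] []; simpl; now rewrite comp_id_l.
Defined.

Lemma binary_product_exists (C : Category) (A B : C) :
  has_finite_limits C -> inhabited (BinProduct A B).
Proof.
  intros Hlim.
  destruct (Hlim _ (pair_functor _ A B) discrete_pair_finite) as [L].
  assert (Hcone : forall S (f : Hom S A) (g : Hom S B),
    is_cone (F := pair_functor _ A B) (L := S)
      (fun i : bool => if i return Hom S (if i then A else B)
                       then f else g)).
  { intros S f g i j []; simpl; apply comp_id_l. }
  constructor.
  refine {| prod_ob := lim_ob L;
            pr1 := lim_leg L true; pr2 := lim_leg L false;
            pair := fun S f g => lim_lift L (Hcone S f g) |}.
  - intros S f g; exact (lim_lift_leg L (Hcone S f g) true).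
  - intros S f g; exact (lim_lift_leg L (Hcone S f g) false).
  - intros S h k H1 H2; apply (lim_ext (l := L)); intros []; assumption.
Qed.

Definition parallel_hom (i j : bool) : Type :=
  match i, j with
  | false, true => bool
  | true, false => Empty_set
  | _, _ => unit
  end.

Definition parallel_comp (i j k : bool) :
  parallel_hom j k -> parallel_hom i j -> parallel_hom i k :=
  match i, j, k
    return parallel_hom j k -> parallel_hom i j -> parallel_hom i k
  with
  | false, false, _ => fun b _ => b
  | true, true, _ => fun b _ => b
  | false, true, true => fun _ a => a
  | false, true, false => fun b _ => match b with end
  | true, false, _ => fun _ a => match a with end
  end.

Definition parallel_pair : Category.
Proof.
  refine {| Ob := bool; Hom := parallel_hom;
            idm := fun i => if i return parallel_hom i i then tt else tt;
            comp := parallel_comp |}.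
  - intros [] [] f; simpl in *; easy || now destruct f.
  - intros [] [] f; simpl in *; easy || now destruct f.
  - intros [] [] [] [] h g f; simpl in *;
      easy || now destruct f || now destruct g || now destruct h.
Defined.

Lemma parallel_pair_finite : finite_category parallel_pair.
Proof.
  split.
  - exists (true :: false :: nil); intros []; simpl; auto.
  - intros [] []; simpl.
    + exists (tt :: nil); intros []; simpl; auto.
    + exists nil; intros [].
    + exists (true :: false :: nil); intros []; simpl; auto.
    + exists (tt :: nil); intros []; simpl; auto.
Qed.

Definition parallel_functor (C : Category) (X Y : C) (f g : Hom X Y) :
  Functor parallel_pair C.
Proof.
  refine {| fobj := fun i : parallel_pair => if i then Y else X;
            fmap := fun i j : bool => match i, j
              return parallel_hom i j ->
                Hom (if i then Y else X) (if j then Y else X)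
              with
              | false, false => fun _ => idm X
              | true, true => fun _ => idm Y
              | false, true => fun a => if a then f else g
              | true, false => fun a => match a with end
              end |}.
  - intros []; reflexivity.
  - intros [] [] [] b a; simpl in *; try destruct a; try destruct b;
      now rewrite ?comp_id_l, ?comp_id_r.
Defined.

Lemma equalizer_exists (C : Category) (X Y : C) (f g : Hom X Y) :
  has_finite_limits C ->
  exists (E : C) (e : Hom E X),
    f ∘ e = g ∘ e /\ is_mono e /\
    forall (S : C) (h : Hom S X), f ∘ h = g ∘ h -> exists l, e ∘ l = h.
Proof.
  intros Hlim.
  destruct (Hlim _ (parallel_functor _ _ _ f g) parallel_pair_finite) as [L].
  pose proof (lim_cone L (i := false) (j := true) true : f ∘ lim_leg L false = _) as Hf.
  pose proof (lim_cone L (i := false) (j := true) false : g ∘ lim_leg L false = _) as Hg.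
  exists (lim_ob L), (lim_leg L false); split; [congruence | split].
  - intros S h k H; apply (lim_ext (l := L)); intros []; [ | exact H].
    rewrite <- Hf, <- !comp_assoc; now rewrite H.
  - intros S h H.
    assert (Hcone : is_cone (F := parallel_functor _ _ _ f g) (L := S)
      (fun i : bool => if i return Hom S (if i then Y else X)
                       then f ∘ h else h)).
    { intros [] [] a; simpl in *; try destruct a;
        rewrite ?comp_id_l; congruence. }
    exists (lim_lift L Hcone); exact (lim_lift_leg L Hcone false).
Qed.

Lemma kernel_relation_exists (C : Category) (X T : C) (XX : BinProduct X X)
  (f : Hom X T) :
  has_finite_limits C ->
  exists R : Relation XX, is_effective_equivalence_relation R /\
    forall (S : C) (a b : Hom S X), related R a b <-> f ∘ a = f ∘ b.
Proof.
  intros Hlim.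
  destruct (equalizer_exists _ _ _ (f ∘ pr1 XX) (f ∘ pr2 XX) Hlim)
    as (E & e & He & Hmono & Hlift).
  exists {| rel_ob := E; rel_incl := e; rel_mono := Hmono |}.
  assert (Hrel : forall (S : C) (a b : Hom S X),
    related {| rel_ob := E; rel_incl := e; rel_mono := Hmono |} a b
    <-> f ∘ a = f ∘ b).
  { intros S a b; split.
    - intros [h Hh]; simpl in *.
      pose proof (pr1_pair XX a b) as Ha; pose proof (pr2_pair XX a b) as Hb.
      rewrite <- Hh in Ha, Hb.
      rewrite <- Ha, <- Hb, !comp_assoc; now rewrite He.
    - intros H; apply Hlift.
      rewrite <- !comp_assoc, pr1_pair, pr2_pair; exact H. }
  split; [split | exact Hrel].
  - intros S; repeat split; intros *; rewrite !Hrel; congruence.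
  - exists T, f; simpl; split.
    + now rewrite !comp_assoc.
    + intros S a b H; apply Hrel in H; destruct H as [h Hh]; simpl in *.
      exists h; split.
      * rewrite <- !comp_assoc, Hh; split; [apply pr1_pair | apply pr2_pair].
      * intros h' [H1 H2]; apply Hmono; rewrite Hh.
        apply pair_ext; rewrite ?pr1_pair, ?pr2_pair, comp_assoc; congruence.
Qed.

Lemma related_kernel (C : Category) (X T : C) (XX : BinProduct X X)
  (R : Relation XX) (f : Hom X T) (S : C) (a b : Hom S X) :
  is_kernel_pair f (pr1 XX ∘ rel_incl R) (pr2 XX ∘ rel_incl R) ->
  related R a b <-> f ∘ a = f ∘ b.
Proof.
  intros [Hf Huniv]; split.
  - intros [h Hh].
    pose proof (pr1_pair XX a b) as Ha; pose proof (pr2_pair XX a b) as Hb.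
    rewrite <- Hh in Ha, Hb; rewrite <- Ha, <- Hb, !comp_assoc.
    rewrite !comp_assoc in Hf; now rewrite Hf.
  - intros H; destruct (Huniv _ _ _ H) as (h & [H1 H2] & _); exists h.
    apply pair_ext; rewrite ?pr1_pair, ?pr2_pair, comp_assoc; assumption.
Qed.

Lemma pair_comp (C : Category) (A B S S' : C) (P : BinProduct A B)
  (f : Hom S A) (g : Hom S B) (h : Hom S' S) :
  pair P f g ∘ h = pair P (f ∘ h) (g ∘ h).
Proof.
  apply pair_ext; now rewrite comp_assoc, ?pr1_pair, ?pr2_pair.
Qed.

Lemma prod_map_pair (C : Category) (A B A' B' S : C)
  (P : BinProduct A B) (P' : BinProduct A' B')
  (f : Hom A A') (g : Hom B B') (a : Hom S A) (b : Hom S B) :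
  prod_map P P' f g ∘ pair P a b = pair P' (f ∘ a) (g ∘ b).
Proof.
  unfold prod_map; rewrite pair_comp, <- !comp_assoc.
  now rewrite pr1_pair, pr2_pair.
Qed.

Lemma pair_eta (C : Category) (A B S : C) (P : BinProduct A B) (h : Hom S P) :
  pair P (pr1 P ∘ h) (pr2 P ∘ h) = h.
Proof.
  apply pair_ext; now rewrite ?pr1_pair, ?pr2_pair.
Qed.

Definition swap_product (C : Category) (A B : C) (P : BinProduct A B) :
  BinProduct B A :=
  {| prod_ob := P; pr1 := pr2 P; pr2 := pr1 P;
     pair := fun S f g => pair P g f;
     pr1_pair := fun S f g => pr2_pair P g f;
     pr2_pair := fun S f g => pr1_pair P g f;
     pair_ext := fun S h k H1 H2 => pair_ext H2 H1 |}.

Lemma zero_map_comp (C : Category) (Z : ZeroObject C) (A B D : C)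
  (f : Hom A B) : zero_map Z B D ∘ f = zero_map Z A D.
Proof.
  unfold zero_map; rewrite <- comp_assoc; f_equal; apply to_zero_uniq.
Qed.

Lemma comp_zero_map (C : Category) (Z : ZeroObject C) (A B D : C)
  (f : Hom B D) : f ∘ zero_map Z A B = zero_map Z A D.
Proof.
  unfold zero_map; rewrite comp_assoc; f_equal; apply from_zero_uniq.
Qed.

Lemma coequalizer_epi (C : Category) (K X X' : C) (u v : Hom K X)
  (q : Hom X X') (T : C) (h k : Hom X' T) :
  is_coequalizer u v q -> h ∘ q = k ∘ q -> h = k.
Proof.
  intros [Hq Huniv] H.
  destruct (Huniv T (k ∘ q)) as (l & _ & Hl).
  - now rewrite <- !comp_assoc, Hq.
  - now rewrite <- (Hl h H), <- (Hl k eq_refl).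
Qed.

Lemma iso_coequalizer (C : Category) (K X X' : C) (u : Hom K X)
  (q : Hom X X') : is_iso q -> is_coequalizer u u q.
Proof.
  intros (p & Hpq & Hqp); split; [reflexivity | intros T h _].
  exists (h ∘ p); split.
  - now rewrite <- comp_assoc, Hpq, comp_id_r.
  - intros k <-; now rewrite <- comp_assoc, Hqp, comp_id_r.
Qed.

Lemma identity_is_iso (C : Category) (X : C) : is_iso (idm X).
Proof.
  exists (idm X); split; apply comp_id_l.
Qed.

Definition regular_epi_times_iso (C : Category) : Prop :=
  forall (X X' Y Y' : C) (f : Hom X X') (g : Hom Y Y')
    (P : BinProduct X Y) (P' : BinProduct X' Y'),
    is_regular_epi f -> is_iso g -> is_regular_epi (prod_map P P' f g).

Definition effective_relations_translate (C : Category) (Z : ZeroObject C) :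
  Prop :=
  forall (A B : C) (AB : BinProduct A B) (ABAB : BinProduct AB AB)
    (R : Relation ABAB),
    is_effective_equivalence_relation R ->
    forall (S : C) (x y : Hom S A) (z : Hom S B),
      related R (pair AB x (zero_map Z S B)) (pair AB y (zero_map Z S B)) ->
      related R (pair AB x z) (pair AB y z).

Lemma P_regular_epi_times_iso (C : Category) :
  has_finite_limits C -> property_P C -> regular_epi_times_iso C.
Proof.
  intros Hlim HP X X' Y Y' f g P P' (K & u & v & Hf) Hg.
  destruct (binary_product_exists _ K Y Hlim) as [KY].
  exists KY, (prod_map KY P u (idm Y)), (prod_map KY P v (idm Y)).
  apply HP; [exact Hf | now apply iso_coequalizer].
Qed.

Lemma P_effective_relations_translate (C : Category) (Z : ZeroObject C) :
  has_finite_limits C -> has_coequalizers C -> property_P C ->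
  effective_relations_translate C Z.
Proof.
  intros Hlim Hcoeq HP A B AB ABAB R (_ & T & f & Hf) S x y z.
  rewrite !(related_kernel _ _ _ _ _ f) by exact Hf; intros H.
  destruct (Hcoeq _ _ x y) as (Q & q & Hq).
  destruct (binary_product_exists _ S Z Hlim) as [SZ].
  destruct (binary_product_exists _ Q B Hlim) as [QB].
  destruct (HP _ _ _ x y q _ _ _ (from_zero Z B) (from_zero Z B) (idm B)
    SZ AB QB Hq (iso_coequalizer _ _ _ _ _ _ (identity_is_iso _ B)))
    as [_ Huniv].
  assert (Hx : forall w : Hom S A,
    prod_map SZ AB w (from_zero Z B) = pair AB w (zero_map Z S B) ∘ pr1 SZ).
  { intros w; unfold prod_map; rewrite pair_comp, zero_map_comp.
    unfold zero_map; now rewrite (to_zero_uniq (pr2 SZ)). }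
  destruct (Huniv T f) as (k & <- & _).
  - rewrite !Hx, !comp_assoc; now rewrite H.
  - rewrite <- !comp_assoc, !prod_map_pair; now rewrite (proj1 Hq).
Qed.

Lemma factor_through_coequalizer_times_identity (C : Category)
  (Z : ZeroObject C) (K X X' Y T : C) (u v : Hom K X) (q : Hom X X')
  (XY : BinProduct X Y) (X'Y : BinProduct X' Y) (f : Hom XY T) :
  has_finite_limits C ->
  effective_relations_translate C Z ->
  is_regular_epi (prod_map XY X'Y q (idm Y)) ->
  is_coequalizer u v q ->
  f ∘ pair XY u (zero_map Z K Y) = f ∘ pair XY v (zero_map Z K Y) ->
  exists k : Hom X'Y T, k ∘ prod_map XY X'Y q (idm Y) = f.
Proof.
  intros Hlim Htr (D & c & d & Hcd & Huniv) Hq Hf.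
  destruct (proj2 Hq T (f ∘ pair XY (idm X) (zero_map Z X Y)))
    as (g & Hg & _).
  { rewrite <- !comp_assoc, !pair_comp, !comp_id_l, !zero_map_comp.
    exact Hf. }
  assert (Hf0 : forall w : Hom D X,
    f ∘ pair XY w (zero_map Z D Y) = g ∘ (q ∘ w)).
  { intros w; rewrite comp_assoc, Hg, <- comp_assoc, pair_comp.
    now rewrite comp_id_l, zero_map_comp. }
  destruct (Huniv T f) as (k & Hk & _); [ | now exists k].
  rewrite <- (pair_eta _ _ _ _ XY c), <- (pair_eta _ _ _ _ XY d) in Hcd |- *.
  rewrite !prod_map_pair, !comp_id_l in Hcd.
  assert (H1 := f_equal (fun h => pr1 X'Y ∘ h) Hcd).
  assert (H2 := f_equal (fun h => pr2 X'Y ∘ h) Hcd).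
  cbv beta in H1, H2; rewrite !pr1_pair in H1; rewrite !pr2_pair in H2.
  rewrite <- H2.
  destruct (binary_product_exists _ XY XY Hlim) as [XYXY].
  destruct (kernel_relation_exists _ _ _ XYXY f Hlim) as (R & HR & Hrel).
  apply Hrel, (Htr _ _ _ _ R HR), Hrel.
  now rewrite !Hf0, H1.
Qed.

Lemma regular_epi_translate_P (C : Category) (Z : ZeroObject C) :
  has_finite_limits C -> regular_epi_times_iso C ->
  effective_relations_translate C Z -> property_P C.
Proof.
  intros Hlim Hepi Htr C1 X X' u v q1 C2 Y Y' u' v' q2 PC PX PX' Hq1 Hq2.
  destruct (binary_product_exists _ X' Y Hlim) as [W].
  assert (He1 : is_regular_epi (prod_map PX W q1 (idm Y))).
  { apply Hepi; [now exists C1, u, v | apply identity_is_iso]. }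
  assert (He2 : is_regular_epi
    (prod_map (swap_product _ _ _ W) (swap_product _ _ _ PX') q2 (idm X'))).
  { apply Hepi; [now exists C2, u', v' | apply identity_is_iso]. }
  assert (Hcomp : prod_map PX PX' q1 q2 =
    prod_map W PX' (idm X') q2 ∘ prod_map PX W q1 (idm Y)).
  { unfold prod_map at 3; rewrite prod_map_pair, !comp_id_l; reflexivity. }
  split.
  - unfold prod_map at 2 4; rewrite !prod_map_pair, !comp_assoc.
    now rewrite (proj1 Hq1), (proj1 Hq2).
  - intros T f Hf.
    assert (Hf' : forall S (a : Hom S C1) (b : Hom S C2),
      f ∘ pair PX (u ∘ a) (u' ∘ b) = f ∘ pair PX (v ∘ a) (v' ∘ b)).
    { intros S a b.
      rewrite <- !(prod_map_pair _ _ _ _ _ _ PC PX), !comp_assoc.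
      now rewrite Hf. }
    destruct (factor_through_coequalizer_times_identity _ Z _ _ _ _ _ u v q1
      PX W f Hlim Htr He1 Hq1) as (g & Hg).
    { specialize (Hf' C1 (idm C1) (zero_map Z C1 C2)).
      now rewrite !comp_id_r, !comp_zero_map in Hf'. }
    destruct (factor_through_coequalizer_times_identity _ Z _ _ _ _ _ u' v' q2
      (swap_product _ _ _ W) (swap_product _ _ _ PX') g Hlim Htr He2 Hq2)
      as (k & Hk).
    { specialize (Hf' C2 (zero_map Z C2 C1) (idm C2)).
      rewrite !comp_id_r, !comp_zero_map, <- Hg, <- !comp_assoc,
        !prod_map_pair, !comp_id_l, !comp_zero_map in Hf'.
      exact Hf'. }
    change (k ∘ prod_map W PX' (idm X') q2 = g) in Hk.
    exists k; split.
    + rewrite Hcomp, comp_assoc.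
      exact (eq_trans (f_equal (fun h => h ∘ _) Hk) Hg).
    + intros k' Hk'; rewrite Hcomp, comp_assoc in Hk'.
      destruct He1 as (D1 & c1 & d1 & He1).
      destruct He2 as (D2 & c2 & d2 & He2).
      apply (coequalizer_epi _ _ _ _ _ _ _ _ _ _ He2).
      refine (eq_trans Hk _).
      apply (coequalizer_epi _ _ _ _ _ _ _ _ _ _ He1).
      exact (eq_trans Hg (eq_sym Hk')).
Qed.

Theorem proposition2 (C : Category) (Z : ZeroObject C)
  (Hlim : has_finite_limits C) (Hcoeq : has_coequalizers C) :
  property_P C <->
  ((forall (X X' Y Y' : C) (f : Hom X X') (g : Hom Y Y')
      (P : BinProduct X Y) (P' : BinProduct X' Y'),
      is_regular_epi f -> is_iso g -> is_regular_epi (prod_map P P' f g)) /\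
   (forall (A B : C) (AB : BinProduct A B) (ABAB : BinProduct AB AB)
      (R : Relation ABAB),
      is_effective_equivalence_relation R ->
      forall (S : C) (x y : Hom S A) (z : Hom S B),
        related R (pair AB x (zero_map Z S B)) (pair AB y (zero_map Z S B)) ->
        related R (pair AB x z) (pair AB y z))).
Proof.
  split.
  - intros HP; split.
    + exact (P_regular_epi_times_iso _ Hlim HP).
    + exact (P_effective_relations_translate _ Z Hlim Hcoeq HP).
  - intros [Hepi Htr]; exact (regular_epi_translate_P _ Z Hlim Hepi Htr).
Qed.
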